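(* The set $\mathcal B_n$ is in one-to-one correspondence with the sets $\mathcal G_n$ and $\mathcal M_n$, for all strictly positive integers $n$.
   Context: $\mathcal G_n$: the set of equivalence classes of finite undirected graphs $G=(G_0,G_1)$ with vertex set $G_0=\{1,\dots,n\}$ and edge set $G_1$, loops and multiple edges allowed, and no isolated vertices (every vertex has valency at least one); $G=(G_0,G_1)$ and $G'=(G_0,G_1')$ are equivalent if there is a bijection $\delta\colon G_1\to G_1'$ such that $e$ and $\delta(e)$ have the same endpoints for every $e\in G_1$. $\mathcal M_n$: the set of symmetric $n\times n$ matrices with nonnegative integer entries in which no row consists only of zeros. A Brauer configuration $\Gamma=(\Gamma_0,\Gamma_1,\mu,\mathfrak o)$ consists of a finite set $\Gamma_0$ of vertices, a finite collection $\Gamma_1$ of labelled finite multisets of elements of $\Gamma_0$, called polygons (differently labelled polygons may be equal as multisets; a $d$-gon is a polygon with $d$ elements counted with multiplicity), a multiplicity function $\mu\colon\Gamma_0\to\mathbb Z_{>0}$, and an orientation $\mathfrak o$, i.e. a choice, for each vertex $\alpha$, of a cyclic ordering of the list of polygons containing $\alpha$, where each $V$ is listed $\mathrm{occ}(\alpha,V)$ times; here $\mathrm{occ}(\alpha,V)$ is the number of times $\alpha$ occurs in $V$ and $\mathrm{val}(\alpha)=\sum_{V\in\Gamma_1}\mathrm{occ}(\alpha,V)$. It is required that every vertex lies in at least one polygon, every polygon has at least two vertices (counted with multiplicity), and every polygon contains a vertex $\alpha$ with $\mathrm{val}(\alpha)\mu(\alpha)>1$. A vertex $\alpha$ is truncated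 if $\mathrm{val}(\alpha)\mu(\alpha)=1$. $\Gamma$ is reduced if every polygon either contains no truncated vertex or is a $2$-gon with exactly one truncated vertex. $\Gamma$ has no self-foldings if no polygon contains a repeated vertex. If $\Gamma$ has exactly $n$ polygons, $\Gamma$ is ordered if a bijection $\{1,\dots,n\}\to\Gamma_1$ is given; the image of $i$ is called the $i$-th polygon. $\mathcal B_n$: the set of equivalence classes of ordered reduced Brauer configurations $\Gamma$ such that $\Gamma$ has no self-foldings, $\Gamma$ has exactly $n$ polygons, and $1\le\mathrm{val}(\alpha)\mu(\alpha)\le2$ for all $\alpha\in\Gamma_0$. Two such $\Gamma$ and $\Gamma'=(\Gamma_0',\Gamma_1',\mu',\mathfrak o')$ are equivalent if there is a bijection $\epsilon\colon\Gamma_0\to\Gamma_0'$ such that, if $\{\alpha_1,\dots,\alpha_r\}$ is the $i$-th polygon of $\Gamma$, then $\{\epsilon(\alpha_1),\dots,\epsilon(\alpha_r)\}$ is the $i$-th polygon of $\Gamma'$. Effectively, two ordered reduced Brauer configurations are equivalent if they differ only in the names of the vertices. *)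

(* Defs.v *)
From mathcomp Require Import all_boot all_order all_algebra.
From mathcomp Require Import finmap multiset.

Set Implicit Arguments.
Unset Strict Implicit.
Unset Printing Implicit Defensive.

(* The set of equivalence classes of A modulo R, for R an equivalence relation *)
(* on A. The type [set T] of mathcomp-classical cannot be used for the classes *)
(* here: it lives in a universe too small for T a type of graphs.              *)
Definition classes (T : Type) (A : T -> Prop) (R : T -> T -> Prop) : Type :=
  {c : T -> Prop | exists2 x, A x & c = (fun y => A y /\ R x y)}.

(* A loop is an edge with a single endpoint. *)
Record graph (n : nat) := Graph {
  edge : finType;
  endpoints : edge -> {set 'I_n};
  endpointsP : forall e, 0 < #|endpoints e| <= 2 }.

Definition valency (n : nat) (G : graph n) (v : 'I_n) : nat :=
  \sum_(e : edge G | v \in endpoints e) (if #|endpoints e| == 1 then 2 else 1).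

Definition no_isolated_vertex (n : nat) (G : graph n) : Prop :=
  forall v, 1 <= valency G v.

Definition graph_equiv (n : nat) (G G' : graph n) : Prop :=
  exists delta : edge G -> edge G',
    bijective delta /\ forall e, endpoints (delta e) = endpoints e.

Definition graph_classes (n : nat) : Type :=
  classes (@no_isolated_vertex n) (@graph_equiv n).

Definition matrices (n : nat) : Type :=
  {M : 'M[nat]_n | (M^T == M)%R && [forall i, row i M != 0%R]}.

(* Elements of [label] name the polygons, so that distinct labels may carry    *)
(* equal multisets. A cyclic ordering is the set of all rotations of a list.   *)
Record brauer_configuration := BrauerConfiguration {
  vertex : finType;
  label : finType;
  polygon : label -> {mset vertex}%mset;
  multiplicity : vertex -> nat;
  orientation : vertex -> seq label -> Prop;
  occ (a : vertex) (V : label) : nat := polygon V a;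
  valence (a : vertex) : nat := \sum_(V : label) occ a V;
  multiplicity_gt0 : forall a, 0 < multiplicity a;
  orientationP : forall a, exists2 s : seq label,
    (forall V, count_mem V s = occ a V) &
    orientation a = (fun t => exists k, t = rot k s);
  vertexP : forall a, exists V, a \in polygon V;
  polygon_size : forall V, 2 <= size (polygon V);
  polygonP : forall V,
    exists2 a, a \in polygon V & 1 < valence a * multiplicity a }.

Definition truncated (C : brauer_configuration) (a : vertex C) : bool :=
  valence a * multiplicity a == 1.

Definition reduced (C : brauer_configuration) : Prop :=
  forall V : label C,
    (forall a, a \in polygon V -> ~~ truncated a) \/
    (size (polygon V) = 2 /\ count (@truncated C) (polygon V) = 1).

Definition no_self_foldings (C : brauer_configuration) : Prop :=
  forall (V : label C) (a : vertex C), occ a V <= 1.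

(* The bijection [ith_label] forces the number of polygons to be n. *)
Record ordered_brauer_configuration (n : nat) := OrderedBrauerConfiguration {
  configuration :> brauer_configuration;
  ith_label : 'I_n -> label configuration;
  ith_label_bij : bijective ith_label }.

Definition ith_polygon (n : nat) (C : ordered_brauer_configuration n)
  (i : 'I_n) : {mset vertex C}%mset := polygon (ith_label C i).

(* Equivalent configurations differ only in the names of their vertices, so    *)
(* the renaming also preserves multiplicities: this is not a consequence of    *)
(* matching the polygons, as a 2-gon whose two vertices have valency 1 may     *)
(* have multiplicities (1, 2) or (2, 2). No clause is needed for orientations  *)
(* when each vertex has valency at most 2, since a list of length at most 2    *)
(* has a unique cyclic ordering.                                               *)
Definition brauer_equiv (n : nat) (C C' : ordered_brauer_configuration n) :
    Prop :=
  exists epsilon : vertex C -> vertex C',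
    [/\ bijective epsilon,
        forall i, ith_polygon C' i =
                  seq_mset [seq epsilon a | a <- ith_polygon C i] &
        forall a, multiplicity (epsilon a) = multiplicity a].

Definition brauer_classes (n : nat) : Type :=
  classes
    (fun C : ordered_brauer_configuration n =>
       [/\ reduced C, no_self_foldings C &
           forall a : vertex C, 1 <= valence a * multiplicity a <= 2])
    (@brauer_equiv n).

(* Main.v *)
Require Import Defs.
From mathcomp Require Import all_boot all_algebra.
From mathcomp Require Import finmap multiset boolp zify.

(* In an admissible configuration a non-truncated vertex either has valency 2  *)
(* and multiplicity 1, so it lies in two distinct polygons i and j, or has     *)
(* valency 1 and multiplicity 2, so it lies in one polygon i. Read it as an  *)
(* edge between i and j, respectively as a loop at i. The truncated vertices   *)
(* carry no further information: reducedness forces the i-th polygon to        *)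
(* contain one exactly when it contains a single non-truncated vertex.         *)
(* Equivalence on both sides, and equality of adjacency matrices, amount to    *)
(* the equality of the numbers of vertices (edges) with a prescribed set of    *)
(* polygons (endpoints).                                                       *)

Set Implicit Arguments.
Unset Strict Implicit.
Unset Printing Implicit Defensive.

(** Graphs are classified by their matrices, and configurations by their graphs. A graph is
    determined up to equivalence by the number of edges on each endpoint set, that is, by
    [adjacency] ([graph_equivP]). Every symmetric matrix arises by drawing [M i j] edges for each
    [i <= j], and nonzero rows mean no isolated vertices. In an admissible configuration, the
    support of a vertex and whether it is truncated determine its multiplicity ([multiplicityE]),
    and the truncated vertices can be counted from the graph ([count_truncated]). So equivalence of
    configurations is equivalence of their graphs ([configuration_graph_equivP]). Conversely, a
    graph becomes a configuration once a truncated vertex is added to each polygon that meets a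
    single edge ([graph_configurationK]). *)

(** * Bijections from complete invariants and from fibre counts *)

(** A complete invariant [m] identifies classes with its values: choose a representative of a class
    one way, a preimage of a value the other. That [R] is an equivalence on [A] follows from the
    second hypothesis. *)
Lemma classes_bij (T Y : Type) (A : T -> Prop) (R : T -> T -> Prop)
    (P : Y -> Prop) (m : T -> Y) :
  (forall x, A x -> P (m x)) ->
  (forall x y, A x -> A y -> R x y <-> m x = m y) ->
  (forall y, P y -> exists2 x, A x & m x = y) ->
  exists f : classes A R -> {y | P y}, bijective f.
Proof.
move=> mP Rm msurj.
pose cls x : T -> Prop := fun y => A y /\ R x y.
have clsE x x' : A x -> A x' -> m x = m x' -> cls x = cls x'.
  move=> Ax Ax' mE; apply/funext => y; apply/propext.
  by split=> -[Ay Rxy]; split=> //; apply/Rm => //; [rewrite -mE|rewrite mE];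
    apply/Rm.
pose rep (c : classes A R) := cid2 (svalP c).
pose f (c : classes A R) : {y | P y} := exist _ _ (mP _ (s2valP (rep c))).
pose pre (y : {y | P y}) := cid2 (msurj _ (svalP y)).
pose g (y : {y | P y}) : classes A R :=
  exist _ (cls (s2val (pre y))) (ex_intro2 _ _ _ (s2valP (pre y)) erefl).
have val_inj (U : Type) (Q : U -> Prop) (u v : {x | Q x}) :
    sval u = sval v -> u = v.
  case: u v => [u Qu] [v Qv] /= uv; subst.
  by congr exist; exact: Prop_irrelevance.
exists f, g => [c|y]; apply: val_inj.
  apply: etrans (esym (s2valP' (rep c))).
  apply: clsE (s2valP (pre _)) (s2valP (rep c)) _.
  exact: (s2valP' (pre (f c))).
rewrite -[RHS](s2valP' (pre y)) /=.
case: (rep (g y)) => x Ax /= E; have Apre := s2valP (pre y).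
have [_ Rx] : cls (s2val (pre y)) x by rewrite E; split=> //; exact/Rm.
by apply/esym/Rm.
Qed.

(** The k-th element of a fibre of [f] goes to the k-th element of the fibre of [f'] over the same
    point, which exists by the bound on cardinals. *)
Lemma fibre_inj (E E' : finType) (X : eqType) (f : E -> X) (f' : E' -> X) :
  (forall x, #|[pred e | f e == x]| <= #|[pred e | f' e == x]|) ->
  exists2 d : E -> E', injective d & forall e, f' (d e) = f e.
Proof.
move=> le_ff'.
pose F x := enum [pred e | f e == x]; pose F' x := enum [pred e | f' e == x].
have /fin_all_exists[d dP] e :
    exists e', f' e' = f e /\ index e' (F' (f e)) = index e (F (f e)).
  have Fe : e \in F (f e) by rewrite /F mem_enum inE.
  have lt_e : index e (F (f e)) < size (F' (f e)).
    by rewrite -cardE (leq_trans _ (le_ff' _)) // cardE index_mem.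
  have uF' : uniq (F' (f e)) by exact: enum_uniq.
  have F'E e' : e' \in F' (f e) -> f' e' = f e by rewrite mem_enum => /eqP.
  case: (F' (f e)) lt_e uF' F'E => // e0 s lt_e us F'E.
  exists (nth e0 (e0 :: s) (index e (F (f e)))); split; last exact: index_uniq.
  exact/F'E/mem_nth.
exists d => [e1 e2 eq_d|e]; last by case: (dP e).
have [f1 i1] := dP e1; have [f2 i2] := dP e2.
have eq_f : f e1 = f e2 by rewrite -f1 -f2 eq_d.
have := i1; rewrite eq_d eq_f i2 => /esym/(index_inj e1); apply;
  by rewrite /F mem_enum inE ?eq_f.
Qed.

Lemma fibre_bij (E E' : finType) (X : eqType) (f : E -> X) (f' : E' -> X) :
  (forall x, #|[pred e | f e == x]| = #|[pred e | f' e == x]|) ->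
  exists2 d : E -> E', bijective d & forall e, f' (d e) = f e.
Proof.
move=> eq_ff'.
have [|d d_inj dE] := @fibre_inj _ _ _ f f'; first by move=> x; rewrite eq_ff'.
have [|g g_inj _] := @fibre_inj _ _ _ f' f; first by move=> x; rewrite eq_ff'.
by exists d => //; apply: inj_card_bij (leq_card _ g_inj).
Qed.

Lemma card_fibre_bij (E E' : finType) (X : eqType) (f : E -> X) (f' : E' -> X)
    (d : E -> E') : bijective d -> (forall e, f' (d e) = f e) ->
  forall x, #|[pred e | f e == x]| = #|[pred e | f' e == x]|.
Proof.
move=> d_bij dE x.
rewrite -(on_card_preimset (onW_bij _ d_bij)); apply: eq_card => e.
by rewrite !inE dE.
Qed.

Lemma card_tag (I : finType) (m : I -> nat) (i : I) :
  #|[pred e : {i : I & 'I_(m i)} | tag e == i]| = m i.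
Proof.
rewrite -[RHS]card_ord -(@card_image _ _ (Tagged (fun i => 'I_(m i)) (i := i))).
  apply: eq_card => -[j k]; rewrite inE /=.
  apply/eqP/imageP => [ji|[k' _ /(congr1 tag)//]].
  by subst j; exists k.
by move=> k k' /eqP; rewrite eq_Tagged => /eqP.
Qed.

Lemma card_sig_fibre (T : finType) (X : eqType) (p : pred T) (f : T -> X) x :
  #|[pred e : {a | p a} | f (val e) == x]| = #|[pred a | p a && (f a == x)]|.
Proof.
rewrite -(card_image val_inj); apply: eq_card => a; rewrite !inE.
apply/imageP/andP => [[e fe ->]|[pa fa]].
  by split; [exact: valP|exact: fe].
by exists (exist _ a pa).
Qed.

Lemma card_sum_pred (T1 T2 : finType) (p : pred (T1 + T2)) :
  #|[pred a | p a]| = #|[pred a | p (inl a)]| + #|[pred b | p (inr b)]|.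
Proof. by rewrite -!sum1_card big_sumType. Qed.

(** * Graphs and symmetric matrices *)

Section GraphMatrix.
Variable n : nat.
Implicit Types (G : graph n) (i j k l : 'I_n) (M : 'M[nat]_n).

Lemma card_le2P (S : {set 'I_n}) :
  0 < #|S| <= 2 -> exists i j, S = [set i; j].
Proof.
rewrite [_ <= 2]leq_eqVlt [_ < 2]ltnS.
case/andP=> [S0 /orP[/cards2P[i [j [_ ->]]]|S1]].
  by exists i, j.
have /cards1P[i ->] : #|S| == 1 by rewrite eqn_leq S0 S1.
by exists i, i; rewrite setUid.
Qed.

Lemma set2_inj i j k l : i <= j -> k <= l -> [set i; j] = [set k; l] ->
  (i, j) = (k, l).
Proof.
move=> ij kl E.
have := set21 k l; have := set22 k l; rewrite -E.
have := set21 i j; have := set22 i j; rewrite {1 2}E !inE -!val_eqE /=.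
by move=> jE iE lE kE; congr pair; apply/val_inj => /=; lia.
Qed.

Lemma no_isolated_vertexP G :
  no_isolated_vertex G <-> forall i, exists e : edge G, i \in endpoints e.
Proof.
split=> [Gi i|Gi i].
  have := Gi i; rewrite lt0n sum_nat_eq0 negb_forall => /existsP[e].
  by rewrite negb_imply => /andP[ie _]; exists e.
by have [e ie] := Gi i; rewrite /valency (bigD1 e) //=; case: ifP.
Qed.

(** A loop counts once on the diagonal, so diagonal entries need not be even. *)
Definition adjacency G : 'M[nat]_n :=
  (\matrix_(i, j) #|[pred e : edge G | endpoints e == [set i; j]]|)%R.

Lemma graph_equiv_count G G' :
  (forall S, #|[pred e : edge G | endpoints e == S]|
           = #|[pred e : edge G' | endpoints e == S]|) -> graph_equiv G G'.
Proof. by move=> /fibre_bij[d d_bij dE]; exists d. Qed.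

(** Unlike in [valency], a loop counts once: this is to match the number of non-truncated vertices
    of the i-th polygon. *)
Definition degree (G : graph n) i := #|[pred e : edge G | i \in endpoints e]|.

Lemma degree_equiv G G' i :
  graph_equiv G G' -> degree G i = degree G' i.
Proof.
move=> [d [d_bij dE]]; rewrite /degree -(on_card_preimset (onW_bij _ d_bij)).
by apply: eq_card => e; rewrite !inE dE.
Qed.

Lemma graph_equivP G G' : graph_equiv G G' <-> adjacency G = adjacency G'.
Proof.
split=> [[d [d_bij dE]]|/matrixP adjE].
  by apply/matrixP => i j; rewrite !mxE; exact: card_fibre_bij dE _.
apply: graph_equiv_count => S.
have [/card_le2P[i [j ->]]|S_big] := boolP (0 < #|S| <= 2).
  by have := adjE i j; rewrite !mxE.
rewrite !eq_card0 // => e; rewrite !inE; apply: contraNF S_big => /eqP <-;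
  exact: endpointsP.
Qed.

Lemma adjacency_sym G : ((adjacency G)^T = adjacency G)%R.
Proof. by apply/matrixP => i j; rewrite !mxE setUC. Qed.

Lemma adjacency_row_neq0 G :
  no_isolated_vertex G <-> [forall i, row i (adjacency G) != 0%R].
Proof.
split=> [/no_isolated_vertexP Gi|/forallP Gi].
  apply/forallP => i; have [e ie] := Gi i; apply/eqP => /rowP rowi.
  have [j eE] : exists j, endpoints e = [set i; j].
    have /card_le2P[k [l eE]] := endpointsP e.
    by move: ie; rewrite eE => /set2P[]->; [exists l|exists k; rewrite setUC].
  by have := rowi j; rewrite !mxE => /card0_eq/(_ e); rewrite !inE eE eqxx.
apply/no_isolated_vertexP => i; have /rV0Pn[j] := Gi i.
rewrite !mxE -lt0n => /card_gt0P[e]; rewrite inE => /eqP eE.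
by exists e; rewrite eE set21.
Qed.

(** Keeping only the pairs with [p.1 <= p.2] lists each unordered pair of endpoints once. *)
Definition upper M (p : 'I_n * 'I_n) : nat :=
  if p.1 <= p.2 then M p.1 p.2 else 0.

Definition matrix_endpoints M (e : {p : 'I_n * 'I_n & 'I_(upper M p)}) :
  {set 'I_n} := [set (tag e).1; (tag e).2].

Lemma matrix_endpointsP M e : 0 < #|@matrix_endpoints M e| <= 2.
Proof. by rewrite cards2; case: (_ != _). Qed.

Definition matrix_graph M : graph n := Graph (@matrix_endpointsP M).

Lemma matrix_graphK M : M^T%R = M -> adjacency (matrix_graph M) = M.
Proof.
move=> Msym; apply/matrixP => i j.
wlog ij : i j / i <= j => [IH|].
  have [/IH//|/ltnW/IH ji] := leqP i j.
  by rewrite -[in RHS]Msym [RHS]mxE -ji !mxE setUC.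
(* Rewriting [true] back into [i <= j] turns the entry into [upper M (i, j)]. *)
rewrite mxE -[RHS]/(if true then M (i, j).1 (i, j).2 else 0) -ij.
rewrite -[RHS](card_tag (upper M) (i, j)).
apply: eq_card => -[[k l] e]; rewrite !inE /matrix_endpoints /=.
(* Otherwise the edge [e] would belong to the empty type ['I_0]. *)
have kl : k <= l.
  by move: e; rewrite /upper /=; case: ifP => // _ [].
rewrite -[matrix_endpoints _]/[set k; l].
by apply/eqP/eqP => [/set2_inj->|[-> ->]].
Qed.
End GraphMatrix.

Lemma graph_matrix_bij n :
  exists f : graph_classes n -> matrices n, bijective f.
Proof.
apply: (@classes_bij _ _ _ _ _ (@adjacency n)).
- by move=> G Gi; rewrite adjacency_sym eqxx -adjacency_row_neq0.
- by move=> G G' _ _; exact: graph_equivP.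
- move=> M /andP[/eqP Ms Mr]; exists (matrix_graph M).
    by apply/adjacency_row_neq0; rewrite matrix_graphK.
  exact: matrix_graphK.
Qed.

(** * From configurations to graphs *)

Lemma count_mem_mset (K : choiceType) (A : {mset K}%mset) a :
  count_mem a A = A a.
Proof. by rewrite -mset_seqE seq_mset_id. Qed.

Lemma map_seq_msetE (K K' : choiceType) (f : K -> K') (A : {mset K}%mset) a :
  injective f -> seq_mset [seq f x | x <- A] (f a) = A a.
Proof.
move=> f_inj; rewrite mset_seqE count_map -count_mem_mset; apply: eq_count => x.
by rewrite /= inj_eq.
Qed.

Section Supports.
Variable n : nat.
Implicit Types (C : ordered_brauer_configuration n) (i : 'I_n).

Definition admissible C : Prop :=
  [/\ reduced C, no_self_foldings C &
      forall a : vertex C, 1 <= valence a * multiplicity a <= 2].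

Definition support C (a : vertex C) : {set 'I_n} :=
  [set i | a \in ith_polygon C i].

Lemma ith_labelP C (V : label C) : exists i, ith_label C i = V.
Proof. by have [g _ gK] := ith_label_bij C; exists (g V). Qed.

Lemma mem_support C a i : (i \in support a) = (a \in ith_polygon C i).
Proof. by rewrite inE. Qed.

Section NoSelfFoldings.
Variable C : ordered_brauer_configuration n.
Hypothesis C_nsf : no_self_foldings C.

Lemma ith_polygonE i (a : vertex C) : ith_polygon C i a = (i \in support a).
Proof.
rewrite mem_support in_mset; have := C_nsf (ith_label C i) a.
by rewrite /occ -/(ith_polygon C i); case: (ith_polygon C i a) => [|[]].
Qed.

Lemma valence_support (a : vertex C) : valence a = #|support a|.
Proof.
rewrite /valence (reindex _ (onW_bij _ (ith_label_bij C))) /=.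
rewrite -sum1_card [RHS]big_mkcond; apply: eq_bigr => i _.
by rewrite /occ -/(ith_polygon C i) ith_polygonE; case: ifP.
Qed.

Lemma count_ith_polygon (p : pred (vertex C)) i :
  count p (ith_polygon C i) = #|[pred a | p a & i \in support a]|.
Proof.
have U : uniq (ith_polygon C i).
  apply: count_mem_uniq => a.
  by rewrite count_mem_mset ith_polygonE mem_support.
rewrite -size_filter -(card_uniqP _); last exact: filter_uniq.
by apply: eq_card => a; rewrite mem_filter !inE.
Qed.

End NoSelfFoldings.

(* The bound on the support holds for all vertices of an admissible            *)
(* configuration; it makes the graph of an arbitrary configuration defined.    *)
Definition configuration_graph_edge C :=
  {a : vertex C | ~~ truncated a && (#|support a| <= 2)}.

Lemma support_gt0 C (a : vertex C) : 0 < #|support a|.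
Proof.
have [V aV] := vertexP a; have [i iV] := ith_labelP V.
by apply/card_gt0P; exists i; rewrite mem_support /ith_polygon iV.
Qed.

Lemma configuration_graph_subproof C (e : configuration_graph_edge C) :
  0 < #|support (val e)| <= 2.
Proof. by rewrite support_gt0; case/andP: (valP e). Qed.

Definition configuration_graph C : graph n :=
  Graph (@configuration_graph_subproof C).

Section Admissible.
Variable C : ordered_brauer_configuration n.
Hypothesis C_adm : admissible C.

Lemma support_mult_le2 (a : vertex C) :
  1 <= #|support a| * multiplicity a <= 2.
Proof. by have [_ nsf C2] := C_adm; rewrite -valence_support. Qed.

Lemma truncatedE (a : vertex C) :
  truncated a = (#|support a| * multiplicity a == 1).
Proof. by have [_ nsf _] := C_adm; rewrite -valence_support. Qed.

Lemma support_le2 (a : vertex C) : #|support a| <= 2.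
Proof.
have /andP[_] := support_mult_le2 a; apply: leq_trans.
by rewrite leq_pmulr // multiplicity_gt0.
Qed.

Lemma truncated_support (a : vertex C) i :
  truncated a -> (support a == [set i]) = (i \in support a).
Proof.
rewrite truncatedE muln_eq1 => /andP[/cards1P[j ->] _].
by rewrite inE eqEcard !cards1 sub1set inE andbT eq_sym.
Qed.

(** For a non-truncated vertex the product of support size and multiplicity is 2, so the two factors
    are 1 and 2 in some order and sum to 3. *)
Lemma multiplicityE (a : vertex C) :
  multiplicity a = if truncated a then 1 else 3 - #|support a|.
Proof.
have := support_mult_le2 a; have := support_gt0 a; rewrite truncatedE.
case: ifP => [|]; first by rewrite muln_eq1 => /andP[_ /eqP].
by move: #|_| (multiplicity a) => k m; nia.
Qed.

Lemma count_configuration_graph S :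
  #|[pred e : edge (configuration_graph C) | endpoints e == S]|
  = #|[pred a : vertex C | (support a, truncated a) == (S, false)]|.
Proof.
rewrite card_sig_fibre; apply: eq_card => a.
by rewrite !inE support_le2 andbT xpair_eqE eqbF_neg andbC.
Qed.

Lemma degree_configuration_graph i :
  degree (configuration_graph C) i =
  count (predC (@truncated C)) (ith_polygon C i).
Proof.
have [_ nsf _] := C_adm.
rewrite count_ith_polygon // /degree -(card_image val_inj); apply: eq_card => a.
rewrite !inE; apply/imageP/andP => [[e ie ->]|[ta ia]].
  by split; [case/andP: (valP e)|rewrite -mem_support].
have pa : ~~ truncated a && (#|support a| <= 2) by rewrite ta support_le2.
by exists (exist _ a pa) => //; rewrite inE /= mem_support.
Qed.

(** By reducedness, a polygon either has no truncated vertex, hence at least two non-truncated ones,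
    or is a 2-gon with one of each kind. *)
Lemma count_truncated i :
  #|[pred a : vertex C | (support a, truncated a) == ([set i], true)]|
  = (degree (configuration_graph C) i == 1).
Proof.
have [red nsf _] := C_adm.
rewrite (_ : #|_| = count (@truncated C) (ith_polygon C i)); last first.
  rewrite count_ith_polygon //; apply: eq_card => a.
  rewrite inE xpair_eqE eqb_id [RHS]inE andbC.
  by case: (boolP (truncated a)) => //= /truncated_support ->.
rewrite degree_configuration_graph; set d := count (predC _) _.
have := count_predC (@truncated C) (ith_polygon C i); rewrite -/d.
have [tP|[-> ->]] := red (ith_label C i); last by rewrite add1n => -[->].
have /eqP : count (@truncated C) (ith_polygon C i) == 0.
  by rewrite -leqn0 leqNgt -has_count; apply/hasPn.
move=> -> sz; have := polygon_size (ith_label C i); rewrite -[size _]sz.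
by case: d {sz} => [|[]].
Qed.

Lemma configuration_graphP : no_isolated_vertex (configuration_graph C).
Proof.
apply/no_isolated_vertexP => i.
have [a ai a2] := polygonP (ith_label C i).
have pa : ~~ truncated a && (#|support a| <= 2).
  by rewrite support_le2 andbT /truncated gtn_eqF.
by exists (exist _ a pa); rewrite mem_support.
Qed.

End Admissible.

Lemma configuration_graph_equivP C C' : admissible C -> admissible C' ->
  brauer_equiv C C' <->
  graph_equiv (configuration_graph C) (configuration_graph C').
Proof.
move=> CA C'A; split=> [[eps [eps_bij epsP epsM]]|eqG].
  have epsS a : support (eps a) = support a.
    apply/setP => i; rewrite !mem_support epsP !in_mset map_seq_msetE //.
    exact: bij_inj.
  apply: graph_equiv_count => S; rewrite !count_configuration_graph //.
  by apply: (card_fibre_bij eps_bij) => a; rewrite !truncatedE // epsS epsM.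
(* Matching vertices by support and truncation suffices: supports give back the polygons, and both
   together the multiplicities. *)
have [[S []]|eps eps_bij epsE] := @fibre_bij _ _ _
    (fun a : vertex C => (support a, truncated a))
    (fun a : vertex C' => (support a, truncated a)).
(* A truncated vertex lies in a single polygon, so only singletons [S] matter; there the count
   depends on the degree alone. *)
- have [/existsP[i /eqP->]|S1] := boolP [exists i, S == [set i]].
    by rewrite !count_truncated // (degree_equiv i eqG).
  rewrite !eq_card0 // => a; rewrite inE; apply: contraNF S1;
    rewrite xpair_eqE eqb_id => /andP[/eqP <-];
    rewrite truncatedE // muln_eq1 => /andP[/cards1P[i ->] _];
    by apply/existsP; exists i.
- rewrite -!count_configuration_graph //.
  by have [d [d_bij dE]] := eqG; exact: card_fibre_bij dE _.
have epsS a : support (eps a) = support a := congr1 fst (epsE a).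
have epsT a : truncated (eps a) = truncated a := congr1 snd (epsE a).
exists eps; split=> // [i|a].
  have [_ nsf _] := CA; have [_ nsf' _] := C'A.
  apply/msetP => b; have [g _ gK] := eps_bij; rewrite -(gK b).
  rewrite map_seq_msetE; last exact: bij_inj.
  by rewrite !ith_polygonE // epsS.
by rewrite !multiplicityE // epsS epsT.
Qed.

(** * Configurations with prescribed supports and multiplicities *)

Section ConfigurationOfSupports.
Variables (V : finType) (s : V -> {set 'I_n}) (mu : V -> nat).
Hypotheses (s_gt0 : forall a, 0 < #|s a|) (mu_gt0 : forall a, 0 < mu a).
Hypothesis s_size : forall i, 2 <= #|[pred a | i \in s a]|.
Hypothesis s_mu : forall i, exists2 a, i \in s a & 1 < #|s a| * mu a.

Definition supports_polygon i : {mset V}%mset :=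
  seq_mset (enum [pred a | i \in s a]).

Lemma supports_polygonE i a : supports_polygon i a = (i \in s a).
Proof. by rewrite mset_seqE count_uniq_mem ?enum_uniq // mem_enum. Qed.

Lemma mem_supports_polygon i a : (a \in supports_polygon i) = (i \in s a).
Proof. by rewrite in_mset supports_polygonE lt0b. Qed.

Lemma count_supports_polygon (p : pred V) i :
  count p (supports_polygon i) = #|[pred a | p a & i \in s a]|.
Proof.
rewrite (permP (perm_eq_seq_mset _)) -size_filter cardE /enum_mem -filter_predI.
by congr (size _); apply: eq_filter => a; rewrite !inE.
Qed.

Lemma size_supports_polygon i :
  size (supports_polygon i) = #|[pred a | i \in s a]|.
Proof. by rewrite -count_predT count_supports_polygon. Qed.

Lemma sum_supports_polygon a : \sum_i supports_polygon i a = #|s a|.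
Proof.
rewrite -sum1_card [RHS]big_mkcond; apply: eq_bigr => i _.
by rewrite supports_polygonE; case: ifP.
Qed.

Fact supports_orientationP a : exists2 t : seq 'I_n,
  (forall i, count_mem i t = supports_polygon i a) &
  (fun u => exists k, u = rot k (enum (s a)))
    = (fun u => exists k, u = rot k t).
Proof.
exists (enum (s a)) => // i.
by rewrite supports_polygonE count_uniq_mem ?enum_uniq // mem_enum.
Qed.

Fact supports_vertexP a : exists i, a \in supports_polygon i.
Proof.
by have /card_gt0P[i ia] := s_gt0 a; exists i; rewrite mem_supports_polygon.
Qed.

Fact supports_polygon_size i : 2 <= size (supports_polygon i).
Proof. by rewrite size_supports_polygon. Qed.

Fact supports_polygonP i : exists2 a, a \in supports_polygon i &
  1 < (\sum_j supports_polygon j a) * mu a.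
Proof.
have [a ia a2] := s_mu i; exists a; first by rewrite mem_supports_polygon.
by rewrite sum_supports_polygon.
Qed.

Definition supports_configuration : ordered_brauer_configuration n :=
  @OrderedBrauerConfiguration n
    (BrauerConfiguration mu_gt0 supports_orientationP supports_vertexP
       supports_polygon_size supports_polygonP)
    id (Bijective (frefl id) (frefl id)).

Lemma supports_configuration_nsf : no_self_foldings supports_configuration.
Proof. by move=> i a; rewrite /occ /= supports_polygonE; case: (_ \in _). Qed.

Lemma support_supports_configuration (a : vertex supports_configuration) :
  support a = s a.
Proof. by apply/setP => i; rewrite mem_support mem_supports_polygon. Qed.

End ConfigurationOfSupports.

(** * From graphs to configurations *)

Section GraphConfiguration.
Variable G : graph n.
Hypothesis G_noiso : no_isolated_vertex G.

(** Edges become the non-truncated vertices; a polygon meeting one edge gets a truncated vertex to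
    reach size 2. *)
Definition graph_vertex : finType := (edge G + {i | degree G i == 1})%type.

Definition graph_support (a : graph_vertex) : {set 'I_n} :=
  match a with inl e => endpoints e | inr i => [set val i] end.

Definition graph_multiplicity (a : graph_vertex) : nat :=
  match a with inl e => 3 - #|endpoints e| | inr _ => 1 end.

Lemma degree_gt0 i : 0 < degree G i.
Proof.
by have /no_isolated_vertexP/(_ i)[e ie] := G_noiso; apply/card_gt0P; exists e.
Qed.

Lemma graph_support_gt0 a : 0 < #|graph_support a|.
Proof. by case: a => [e|i] /=; [case/andP: (endpointsP e)|rewrite cards1]. Qed.

Lemma graph_multiplicity_gt0 a : 0 < graph_multiplicity a.
Proof.
by case: a => [e|//] /=; rewrite subn_gt0; case/andP: (endpointsP e).
Qed.

Lemma graph_support_mult a :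
  #|graph_support a| * graph_multiplicity a = if a is inl _ then 2 else 1.
Proof.
case: a => [e|i] /=; last by rewrite cards1.
by case: #|_| (endpointsP e) => [|[|[|]]].
Qed.

Lemma card_graph_truncated i :
  #|[pred j : {i | degree G i == 1} | i \in [set val j]]| = (degree G i == 1).
Proof.
case: (boolP (degree G i == 1)) => [di|di].
  rewrite (eq_card1 (x := exist _ i di)) // => j.
  by rewrite !inE -val_eqE /= eq_sym.
apply: eq_card0 => j; rewrite !inE; apply: contraNF di => /eqP ->.
exact: (valP j).
Qed.

Lemma graph_support_size i : 2 <= #|[pred a | i \in graph_support a]|.
Proof.
rewrite card_sum_pred card_graph_truncated -/(degree G i).
by case: (degree G i) (degree_gt0 i) => [|[]].
Qed.

Lemma graph_support_mu i :
  exists2 a, i \in graph_support a &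
    1 < #|graph_support a| * graph_multiplicity a.
Proof.
have /no_isolated_vertexP/(_ i)[e ie] := G_noiso.
by exists (inl e); rewrite ?graph_support_mult.
Qed.

Definition graph_configuration : ordered_brauer_configuration n :=
  supports_configuration graph_support_gt0 graph_multiplicity_gt0
    graph_support_size graph_support_mu.

Lemma graph_configuration_valence_mult (a : vertex graph_configuration) :
  valence a * multiplicity a = if a is inl _ then 2 else 1.
Proof.
rewrite valence_support; last exact: supports_configuration_nsf.
by rewrite support_supports_configuration graph_support_mult.
Qed.

Lemma graph_configuration_truncated (a : vertex graph_configuration) :
  truncated a = if a is inl _ then false else true.
Proof. by rewrite /truncated graph_configuration_valence_mult; case: a. Qed.

Lemma graph_configuration_admissible : admissible graph_configuration.
Proof.
split=> [i||a]; last 2 first.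
- exact: supports_configuration_nsf.
- by rewrite graph_configuration_valence_mult; case: a.
have [di|di] := boolP (degree G i == 1); [right|left=> a].
  split.
    rewrite size_supports_polygon card_sum_pred card_graph_truncated di.
    by rewrite -/(degree G i) (eqP di).
  rewrite count_supports_polygon card_sum_pred -[RHS]/(nat_of_bool true) -di.
  rewrite eq_card0 => [|e]; last by rewrite !inE graph_configuration_truncated.
  rewrite -card_graph_truncated; apply: eq_card => j.
  by rewrite !inE graph_configuration_truncated.
rewrite mem_supports_polygon graph_configuration_truncated.
by case: a => // j; rewrite inE => /eqP ij; rewrite ij (valP j) in di.
Qed.

Lemma graph_configurationK :
  graph_equiv (configuration_graph graph_configuration) G.
Proof.
apply: graph_equiv_count => S.
rewrite count_configuration_graph; last exact: graph_configuration_admissible.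
rewrite (@card_sum_pred (edge G)) [X in _ + X]eq_card0 ?addn0.
  apply: eq_card => e; rewrite !inE xpair_eqE support_supports_configuration.
  by rewrite graph_configuration_truncated andbT.
by move=> j; rewrite !inE xpair_eqE graph_configuration_truncated andbF.
Qed.
End GraphConfiguration.
End Supports.

(** * The bijections between classes *)

Lemma brauer_graph_bij n :
  exists f : brauer_classes n -> graph_classes n, bijective f.
Proof.
have graph_refl (G : graph n) : graph_equiv G G by exact/graph_equivP.
(* The invariant of [C] is the class of its graph, as a predicate, so that its values form
   [graph_classes n]. *)
apply: (@classes_bij _ _ _ _ _ (fun C G =>
    no_isolated_vertex G /\ graph_equiv (configuration_graph C) G)).
- move=> C CA; exists (configuration_graph C) => //.
  exact: configuration_graphP.
- move=> C C' CA C'A; rewrite configuration_graph_equivP //.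
  rewrite graph_equivP; split=> [E|E].
    by apply/funext => G; rewrite !(propext (graph_equivP _ G)) E.
  (* The two classes are equal, so the graph of [C'], a member of its own class, lies in that of
     [C]. *)
  have : no_isolated_vertex (configuration_graph C') /\
      graph_equiv (configuration_graph C) (configuration_graph C').
    by rewrite (congr1 (@^~ _) E); split=> //; exact: configuration_graphP.
  by case=> _ /graph_equivP.
- move=> _ [G Gi ->]; exists (graph_configuration Gi).
    exact: graph_configuration_admissible.
  have /graph_equivP E := graph_configurationK Gi.
  by apply/funext => H; rewrite !(propext (graph_equivP _ H)) E.
Qed.

Theorem proposition4p3 : forall n : nat, 0 < n ->
  (exists f : brauer_classes n -> graph_classes n, bijective f) /\
  (exists g : brauer_classes n -> matrices n, bijective g).
Proof.
move=> n _; have [f f_bij] := brauer_graph_bij n.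
have [h h_bij] := graph_matrix_bij n.
by split; [exists f|exists (h \o f); exact: bij_comp].
Qed.
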